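(* Let $m>2^{16}$ be an integer and let $k\ge1$ be an integer such that $k\le\frac12\sqrt{\log_2 m/\log_2\log_2 m}$. Let $n\ge 1$ be an integer with $n\le(\log_2 m)^{k/3}$. Then $\chi^n(m)\le(2k-1)n$; that is, there is an algorithm that loads any $n$ keys, presented online, into an array of size $m$ with amortized cost at most $2k-1$ per key.
   Context: Interval notation denotes sets of integers. For a finite set $Y$ of integers (''keys''), a storage function for $Y$ is a strictly order preserving map $f:Y\to[1,m]$ ($x<y$ implies $f(x)<f(y)$); $[1,m]$ is the set of cells of an array of size $m$. The online labeling (array loading) game with $n$ keys and array size $m\ge n$ is played by an adversary and a (deterministic) algorithm in $n$ steps. At step $t\in[1,n]$ the adversary selects an integer key $y^t\notin\{y^1,\dots,y^{t-1}\}$, and the algorithm, before seeing later keys, responds with a storage function $f^t$ for the set $Y^t=\{y^1,\dots,y^t\}$. A key $y\in Y^t$ is relocated at step $t$ if $y=y^t$ or $f^t(y)\ne f^{t-1}(y)$; $Rel^t$ is the set of keys relocated at step $t$. The total cost is $\sum_{t=1}^n|Rel^t|$. $\chi^n(m)$ denotes the smallest worst-case total cost that an algorithm can achieve against the best adversary, with no bound on the range from which the keys are taken; amortized cost per key means total cost divided by $n$. *)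

(* Defs.v *)
From mathcomp Require Import all_boot all_order all_algebra.
From mathcomp Require Import all_classical all_reals all_analysis.

Set Implicit Arguments.
Unset Strict Implicit.
Unset Printing Implicit Defensive.

Import Order.TTheory GRing.Theory Num.Theory.
Local Open Scope classical_set_scope.
Local Open Scope ring_scope.

(* A storage function for a key set [Y] is a total map whose values off [Y]
   are junk; neither the rules nor the cost of the game look at them. *)
Definition storage_function (m : nat) (Y : seq int) (f : int -> nat) : Prop :=
  {in Y, forall y, (1 <= f y <= m)%N} /\
  {in Y &, forall x y, x < y -> (f x < f y)%N}.

(* A deterministic algorithm: [A [:: y1; ...; yt]] is its response [f^t] once
   the keys [y1], ..., [yt] have been presented in this order.  Its own earlier
   responses are determined by the keys, hence are not passed to it. *)
Definition algorithm := seq int -> int -> nat.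

Definition valid_algorithm (n m : nat) (A : algorithm) : Prop :=
  forall s : seq int, uniq s -> (size s <= n)%N -> storage_function m s (A s).

(* The keys relocated at step [t], for [1 <= t <= size s]; it is duplicate-free
   when [s] is, so that its size is the cardinality of [Rel^t]. *)
Definition Rel (A : algorithm) (s : seq int) (t : nat) : seq int :=
  [seq y <- take t s |
     (y == nth 0 s t.-1) || (A (take t s) y != A (take t.-1 s) y)].

Definition total_cost (A : algorithm) (s : seq int) : nat :=
  (\sum_(1 <= t < (size s).+1) size (Rel A s t))%N.

(* An adversary chooses the next key from the pairs (key, response) of all the
   previous steps. *)
Definition adversary := seq (int * (int -> nat)) -> int.

Definition valid_adversary (n : nat) (B : adversary) : Prop :=
  forall h, uniq (unzip1 h) -> (size h < n)%N -> B h \notin unzip1 h.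

Fixpoint play (A : algorithm) (B : adversary) (t : nat) :
    seq (int * (int -> nat)) :=
  if t is u.+1 then
    let h := play A B u in
    let y := B h in
    rcons h (y, A (rcons (unzip1 h) y))
  else [::].

Definition worst_case_cost (R : realType) (n : nat) (A : algorithm) : \bar R :=
  ereal_sup [set ((total_cost A (unzip1 (play A B n)))%:R)%:E
            | B in [set B | valid_adversary n B]].

(* The total costs are integers, so the infimum is attained as soon as a valid
   algorithm exists, i.e. for [n <= m]; it is [+oo] otherwise. *)
Definition chi (R : realType) (n m : nat) : \bar R :=
  ereal_inf [set worst_case_cost R n A
            | A in [set A | valid_algorithm n m A]].

Definition log2 (R : realType) (x : R) : R := ln x / ln 2.

(* Main.v *)
Require Import Defs.
From mathcomp Require Import all_boot all_order all_algebra.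
From mathcomp Require Import all_classical all_reals all_analysis.
From mathcomp Require Import zify lra.

(* The cells are numbers of [k] digits in base [r * 2 ^ r] and carry a tree of
   height [k] in the manner of a B-tree: the keys below a node of height [h]
   share the [k - h] leading digits of their cell and number between [r ^ h]
   and [2 * r ^ h - 1].  A child that would reach [2 * r ^ h] keys is split into
   two perfectly balanced ones, the new one halving the gap of digits to its
   right.  A node starts with [r] children and gaps [2 ^ r], and has fewer than
   [2 * r] children when one of them splits, so the gap can always be halved.  A split at height [h]
   relocates [2 * r ^ h - 1] keys after [r ^ h] insertions at this node; letting
   each key in excess of [r ^ h] store [2] units at each non-root node gives the
   amortized cost [2 * k - 1].  With [r] the integer part of [sqrt (log2 m)],
   [k] digits fit into [m] and [n < r ^ k]. *)

Set Implicit Arguments.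
Unset Strict Implicit.
Unset Printing Implicit Defensive.

Import Order.TTheory GRing.Theory Num.Theory.

(** * Trees of cells and local rewrites *)

Definition base (r : nat) : nat := r * 2 ^ r.

(** The sentinel [top] guarantees a gap to the right of the last digit as well. *)
Definition spaced (g top : nat) (ds : seq nat) : bool :=
  sorted (fun x y => x + g <= y) (rcons ds top).

Definition spread (W : nat) (c : nat * (seq nat * nat)) : seq nat :=
  [seq c.1 * W + x | x <- c.2.1].

(* [l] lists the occupied cells below a node of height [h], relative to its first
   cell, and [phi] is the potential stored in it.  A child [(d, (s, f))] has
   digit [d], cells [s] and potential [f]. *)
Fixpoint node (r h : nat) (l : seq nat) (phi : nat) : Prop :=
  if h is h'.+1 then
    exists cs : seq (nat * (seq nat * nat)),
      [/\ l = flatten [seq spread (base r ^ h') c | c <- cs],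
          phi = \sum_(c <- cs) (c.2.2 + 2 * (size c.2.1 - r ^ h')),
          head 1 l = 0,
          spaced (2 ^ (2 * r - size cs)) (base r) [seq c.1 | c <- cs]
        & forall c, c \in cs ->
            node r h' c.2.1 c.2.2 /\ r ^ h' <= size c.2.1 < 2 * r ^ h']
  else l = [:: 0] /\ phi = 0.

(* The transition from [l] to [l'] inserts an element just after position [p] and
   changes at most [c] cells.  The first element [x] of the rewritten segment
   stays in place. *)
Definition local_rewrite (l l' : seq nat) (p c : nat) : Prop :=
  exists a x b b' e,
    [/\ l = a ++ x :: b ++ e, l' = a ++ x :: b' ++ e,
        size b' = (size b).+1, size a <= p <= size a + size b & c = size b'].

Lemma local_rewrite_ctx (f : nat -> nat) u v l l' p c :
  local_rewrite l l' p c ->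
  local_rewrite (u ++ map f l ++ v) (u ++ map f l' ++ v) (size u + p) c.
Proof.
case=> a [x [b [b' [e [-> -> sb pab ->]]]]].
exists (u ++ map f a), (f x), (map f b), (map f b'), (map f e ++ v).
split; rewrite ?size_cat ?size_map //; try lia.
- by rewrite map_cat /= map_cat -!catA /= -catA.
- by rewrite map_cat /= map_cat -!catA /= -catA.
Qed.

Lemma locate (T : Type) (f : T -> seq nat) (cs : seq T) (p : nat) :
  p < size (flatten (map f cs)) ->
  exists cs1 c cs2 q,
    [/\ cs = cs1 ++ c :: cs2, p = size (flatten (map f cs1)) + q
      & q < size (f c)].
Proof.
elim: cs p => [|c cs IH] p //=; rewrite size_cat => pP.
have [plt|ple] := ltnP p (size (f c)); first by exists [::], c, cs, p.
have /IH[cs1 [c' [cs2 [q [-> pq qc]]]]] : p - size (f c) < size (flatten (map f cs)).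
  by lia.
by exists (c :: cs1), c', cs2, q; split => //=; rewrite size_cat; lia.
Qed.

(** The default 1 in [head 1 l = 0] excludes the empty list. That all nodes begin at offset 0 later
    lets a split keep its first cell in place. *)
Lemma node_head r h l phi : node r h l phi -> exists s, l = 0 :: s.
Proof.
case: h => [[-> _]|h [cs [_ _ + _ _]]]; first by exists [::].
by case: l => [|x s] //= ->; exists s.
Qed.

Lemma spaced_sorted g top ds : 0 < g -> spaced g top ds -> sorted ltn (rcons ds top).
Proof. by move=> g0; apply: sub_sorted => x y /=; lia. Qed.

(** The cells of [c] lie between [c.1 * W] and [c.1 * W + W - 1], and increasing digits make these
    blocks disjoint. The lower bound carries the induction; the upper one serves the next level of
    the tree. *)
Lemma flatten_spread_sorted W top (cs : seq (nat * (seq nat * nat))) :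
  sorted ltn (rcons [seq c.1 | c <- cs] top) ->
  (forall c, c \in cs -> sorted ltn c.2.1 /\ all (gtn W) c.2.1) ->
  [/\ sorted ltn (flatten [seq spread W c | c <- cs]),
      all (leq (head top [seq c.1 | c <- cs] * W))
          (flatten [seq spread W c | c <- cs])
    & all (gtn (top * W)) (flatten [seq spread W c | c <- cs])].
Proof.
elim: cs => [|c cs IH] //= pP csP.
have [] := IH (path_sorted pP).
  by move=> c' c'cs; apply: csP; rewrite inE c'cs orbT.
move=> sF lF gF; have [sc gc] := csP c (mem_head _ _).
have clt : c.1 < head top [seq c0.1 | c0 <- cs].
  by case: (cs) pP => [|c' cs'] /=; case/andP.
have ctop : c.1 < top.
  move: pP; rewrite path_sortedE; last exact: ltn_trans.
  by case/andP; rewrite all_rcons => /andP[].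
have cW : W + c.1 * W <= head top [seq c0.1 | c0 <- cs] * W.
  by rewrite -mulSn leq_mul2r clt orbT.
have topW : W + c.1 * W <= top * W by rewrite -mulSn leq_mul2r ctop orbT.
have cx x : x \in spread W c -> c.1 * W <= x < W + c.1 * W.
  by case/mapP=> z zc ->; move/allP: gc => /(_ _ zc) /=; lia.
split.
- rewrite (sorted_pairwise ltn_trans) pairwise_cat -!(sorted_pairwise ltn_trans).
  rewrite sF andbT; apply/andP; split.
    apply/allrelP => x y /cx xP yP; move/allP: lF => /(_ _ yP) /=; lia.
  rewrite /spread sorted_map; apply: sub_sorted sc => x y /=; lia.
- rewrite all_cat; apply/andP; split; apply/allP => x.
    by move/cx; lia.
  by move/(allP lF) => /=; lia.
- rewrite all_cat gF andbT; apply/allP => x /cx /=; lia.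
Qed.

Lemma node_sorted r h l phi :
  node r h l phi -> sorted ltn l /\ all (gtn (base r ^ h)) l.
Proof.
elim: h l phi => [|h IH] l phi; first by case=> -> _.
case=> cs [-> _ _ sp csP].
have [] := @flatten_spread_sorted (base r ^ h) (base r) cs.
- by apply: spaced_sorted sp; rewrite expn_gt0.
- by move=> c /csP[/IH].
by rewrite expnS; split.
Qed.

(** * Perfectly balanced nodes *)

Fixpoint full_node (r h : nat) : seq nat :=
  if h is h'.+1 then
    flatten [seq [seq i * 2 ^ r * base r ^ h' + x | x <- full_node r h']
            | i <- iota 0 r]
  else [:: 0].

Lemma size_full_node r h : size (full_node r h) = r ^ h.
Proof.
elim: h => //= h IH; rewrite size_flatten /shape -map_comp.
rewrite (eq_map (g := fun=> r ^ h)); last by move=> i /=; rewrite size_map IH.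
rewrite expnS -[X in _ = X * _](size_iota 0 r); elim: (iota 0 r) => //= i s ->.
by rewrite mulSn.
Qed.

Lemma node_full_node r h : 0 < r -> node r h (full_node r h) 0.
Proof.
move=> r0; elim: h => //= h IH.
exists [seq (i * 2 ^ r, (full_node r h, 0)) | i <- iota 0 r]; split.
- by rewrite -map_comp.
- rewrite big_map big1_seq // => i _ /=.
  by rewrite size_full_node subnn.
- case: r r0 IH => // r _ /node_head[s] /= ->.
  by rewrite /= !mul0n.
- rewrite size_map size_iota -map_comp /spaced.
  (* The sentinel [base r] is the next term [r * 2 ^ r] of the progression of digits. *)
  rewrite (_ : rcons _ _ = [seq i * 2 ^ r | i <- iota 0 r.+1]); last first.
    by rewrite -[r.+1]addn1 iotaD map_cat cats1.
  rewrite sorted_map (_ : 2 * r - r = r); last lia.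
  by apply: sub_sorted (iota_ltn_sorted 0 r.+1) => x y /=; nia.
- move=> c /mapP[i _ -> /=]; split => //.
  rewrite size_full_node leqnn /=.
  have : 0 < r ^ h by rewrite expn_gt0 r0.
  by lia.
Qed.

(** * Insertion into a node *)

Lemma spaced_split g top ds1 d ds2 :
  spaced (2 * g) top (ds1 ++ d :: ds2) ->
  spaced g top (ds1 ++ d :: d + g :: ds2).
Proof.
rewrite /spaced !rcons_cat /=.
have H : sorted (fun x y => x + 2 * g <= y) (ds1 ++ d :: rcons ds2 top) ->
  sorted (fun x y => x + g <= y) (ds1 ++ d :: rcons ds2 top).
  by apply: sub_sorted => x y; lia.
(* Only the gap after [d] is cut, leaving [g] on either side of [d + g]; the other gaps merely
   weaken from [2 * g] to [g]. *)
have E : path (fun x y => x + 2 * g <= y) d (rcons ds2 top) ->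
  path (fun x y => x + g <= y) d (rcons ds2 top) ->
  path (fun x y => x + g <= y) d (d + g :: rcons ds2 top).
  by case: ds2 {H} => [|d2 ds2] /= /andP[le1 _] /andP[_ h];
    rewrite leqnn ?h ?andbT /=; lia.
move=> sp; have := H sp; move: sp.
case: ds1 {H} => [|d1 ds1] //=; rewrite !cat_path.
move=> /andP[_ /andP[_ h1]] /andP[h3 /andP[h4 h2]].
by rewrite h3 /= h4; apply: E.
Qed.

Lemma head_cat_cons (a e e' : seq nat) x :
  head 1 (a ++ x :: e) = head 1 (a ++ x :: e').
Proof. by case: a. Qed.

Lemma size_flatten_spread_ge W w (cs : seq (nat * (seq nat * nat))) :
  (forall c, c \in cs -> w <= size c.2.1) ->
  size cs * w <= size (flatten [seq spread W c | c <- cs]).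
Proof.
elim: cs => //= c cs IH csP; rewrite size_cat /spread size_map mulSn.
apply: leq_add; first exact/csP/mem_head.
by apply: IH => c' c'cs; apply: csP; rewrite inE c'cs orbT.
Qed.

(** Each level adds 2 to the budget. If the child has room, they pay for its larger excess over
    [r ^ h]. Otherwise its split frees [2 * (r ^ h - 1)] units, which with these 2 cover the cost
    [2 * r ^ h - 1] and the extra 1. A leaf never has room, so height 0 is vacuous. *)
Lemma node_insert r h l phi p :
  node r h l phi -> (size l).+1 < 2 * r ^ h -> p < size l ->
  exists l' phi' c, [/\ local_rewrite l l' p c, node r h l' phi'
                      & c + phi' + 1 <= phi + 2 * h].
Proof.
elim: h l phi p => [|h IH] l phi p; first by case=> -> _ /=; lia.
case=> cs [lE phiE hl sp csP] szl pl.
set W := base r ^ h in lE.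
have rh0 : 0 < r ^ h by move: szl; rewrite expnS; case: (r ^ h); lia.
have szcs : size cs < 2 * r.
  have : size cs * r ^ h <= size l.
    by rewrite lE; apply: size_flatten_spread_ge => c /csP[_ /andP[]].
  by move: szl; rewrite expnS; nia.
move: pl; rewrite {1}lE => /locate[cs1 [[d [s f]] [cs2 [q [csE pE]]]]].
rewrite size_map /= => qs.
have [/= nc szs] := csP (d, (s, f)) ltac:(by rewrite csE mem_cat mem_head orbT).
have lE' : l = flatten [seq spread W c | c <- cs1] ++ [seq d * W + x | x <- s]
             ++ flatten [seq spread W c | c <- cs2].
  by rewrite lE csE map_cat flatten_cat.
have [small|big] := ltnP (size s).+1 (2 * r ^ h).
  have [s' [f' [c [rw ns' cost]]]] := IH _ _ _ nc small qs.
  have rwl := local_rewrite_ctx (fun x => d * W + x)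
     (flatten [seq spread W c | c <- cs1]) (flatten [seq spread W c | c <- cs2]) rw.
  rewrite -lE' -pE in rwl.
  have szs' : size s' = (size s).+1.
    case: rw => a [x [b [b' [e [-> -> sb _ _]]]]].
    by rewrite !size_cat /= !size_cat sb; lia.
  eexists; exists (\sum_(c <- cs1 ++ (d, (s', f')) :: cs2)
                     (c.2.2 + 2 * (size c.2.1 - r ^ h))), c.
  split; first exact: rwl.
  - exists (cs1 ++ (d, (s', f')) :: cs2); split => //.
    + by rewrite map_cat flatten_cat.
    + move: hl; case: rwl => a [x [b [b' [e [-> -> _ _ _]]]]].
      by rewrite (head_cat_cons _ _ (b' ++ e)).
    + by move: sp; rewrite csE !map_cat !size_cat.
    + move=> c'; rewrite mem_cat inE orbCA => /orP[/eqP -> /=|c'cs].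
        by split => //; lia.
      by apply: csP; rewrite csE mem_cat inE orbCA c'cs orbT.
  - by move: phiE; rewrite csE !big_cat !big_cons /= szs' => ->; lia.
have szsE : (size s).+1 = 2 * r ^ h by lia.
have r0 : 0 < r by lia.
(* Half the current gap, which is the gap demanded once there is one more child. *)
pose g := 2 ^ (2 * r - (size cs).+1).
pose csn := cs1 ++ (d, (full_node r h, 0)) :: (d + g, (full_node r h, 0)) :: cs2.
have [s1 s1E] := node_head nc.
have [t tE] := node_head (node_full_node h r0).
have szt : (size t).+1 = r ^ h by rewrite -(size_full_node r h) tE.
(* The split child and its replacement both begin at [d * W + 0], so one of the [2 * r ^ h] new
   entries costs nothing. *)
have rwl : local_rewrite l (flatten [seq spread W c | c <- csn]) p (2 * r ^ h - 1).
  exists (flatten [seq spread W c | c <- cs1]), (d * W + 0),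
     [seq d * W + x | x <- s1],
     ([seq d * W + x | x <- t] ++ spread W (d + g, (full_node r h, 0))),
     (flatten [seq spread W c | c <- cs2]).
  have szs1 : (size s1).+1 = size s by rewrite s1E.
  split.
  - by rewrite lE' s1E.
  - by rewrite map_cat flatten_cat /= -!catA {1}/spread /= tE.
  - by rewrite size_cat !size_map size_full_node /=; lia.
  - by rewrite size_map pE; lia.
  - by rewrite size_cat !size_map size_full_node /=; lia.
exists (flatten [seq spread W c | c <- csn]),
  (\sum_(c <- csn) (c.2.2 + 2 * (size c.2.1 - r ^ h))), (2 * r ^ h - 1).
split=> //.
- exists csn; split => //.
  + move: hl; case: rwl => a [x [b [b' [e [-> -> _ _ _]]]]].
    by rewrite (head_cat_cons _ _ (b' ++ e)).
  + rewrite /csn map_cat /= (_ : size _ = (size cs).+1); last first.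
      by rewrite csE !size_cat /=; lia.
    apply: spaced_split; move: sp; rewrite -expnS subnSK //.
    by rewrite csE map_cat.
  + have nf : node r h (full_node r h) 0 /\
              r ^ h <= size (full_node r h) < 2 * r ^ h.
      by split; [exact: node_full_node | rewrite size_full_node; lia].
    move=> c'; rewrite mem_cat !inE => c'P.
    have [c'cs|] := boolP (c' \in cs1 ++ cs2).
      apply: csP; move: c'cs; rewrite csE !mem_cat inE.
      by case/orP => ->; rewrite ?orbT.
    rewrite mem_cat => /norP[/negPf n1 /negPf n2].
    by move: c'P; rewrite n1 n2 orbF /= => /orP[] /eqP ->.
- move: phiE; rewrite csE /csn !big_cat !big_cons /= size_full_node subnn => ->.
  by lia.
Qed.

(** * Ranks and relocated keys *)

Definition rank (s : seq int) (y : int) : nat := count (fun z => (z < y)%R) s.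

Lemma rank_rcons s y z : rank (rcons s y) z = rank s z + (y < z)%R.
Proof. by rewrite /rank -cats1 count_cat /= addn0. Qed.

Lemma rank_lt s x y : (x < y)%R -> rank s x + (x \in s) <= rank s y.
Proof.
by move=> xy; elim: s => //= z s; rewrite inE; case: (x \in s); lia.
Qed.

Lemma rank_mono s x y : x \in s -> (x < y)%R -> rank s x < rank s y.
Proof. by move=> xs /(@rank_lt s); rewrite xs addn1. Qed.

Lemma rank_size s x : x \in s -> rank s x < size s.
Proof.
move=> xs; rewrite -(count_predC (fun z => (z < x)%R)) -[X in X < _]addn0 ltn_add2l.
by rewrite -has_count; apply/hasP; exists x => //=; rewrite ltxx.
Qed.

Lemma rank_inj s : {in s &, injective (rank s)}.
Proof.
move=> x y xs ys rxy; case: (ltgtP x y) => // [/(rank_mono xs)|/(rank_mono ys)];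
  by rewrite rxy ltnn.
Qed.

(** The key [z] sits at index [N + rank s z]. Keys below [y] keep their index and those above move
    up by one, as do the entries before and after the rewritten segment. So the new index of a
    relocated key falls into [b'], and distinct keys have distinct indices. *)
Lemma relocated_le l l' p c N (s : seq int) y :
  local_rewrite l l' p c -> uniq (rcons s y) -> p.+1 = N + rank s y ->
  size [seq z <- rcons s y | (z == y) ||
     (nth 0 l' (N + rank (rcons s y) z) != nth 0 l (N + rank s z))] <= c.
Proof.
case=> a [x [b [b' [e [-> -> sb /andP[ap pb] ->]]]]] us pE.
rewrite -!cat_rcons -(size_iota (size a).+1 (size b')).
set t := (X in size X <= _).
rewrite -(size_map (fun z => N + rank (rcons s y) z)); apply: uniq_leq_size.
  rewrite map_inj_in_uniq ?filter_uniq // => u v.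
  rewrite !mem_filter => /andP[_ us'] /andP[_ vs] /addnI; exact: rank_inj.
move=> _ /mapP[z zt ->]; move: zt; rewrite mem_filter mem_iota => /andP[+ zs].
rewrite rank_rcons; case: (ltgtP z y) => [zy|yz|-> _] /=; last by lia.
- have zs0 : z \in s by move: zs; rewrite mem_rcons inE lt_eqF.
  have := rank_mono zs0 zy; rewrite addn0 => rzy.
  have [ia|] := leqP (N + rank s z) (size a); last by lia.
  by rewrite !nth_cat size_rcons ltnS ia eqxx.
- have := rank_lt s yz => ryz.
  have [|ia] := ltnP (N + rank s z) ((size a).+1 + size b); first by lia.
  rewrite !catA !nth_cat !size_cat !size_rcons sb.
  rewrite !ifF; [|lia..].
  by rewrite (_ : _ - _ = N + rank s z - ((size a).+1 + size b)) ?eqxx //; lia.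
Qed.

(** * The online algorithm and its amortized cost *)

Lemma insertion_strategy r h :
  exists ins : seq nat * nat -> nat -> seq nat * nat, forall st p,
    node r h st.1 st.2 -> (size st.1).+1 < 2 * r ^ h -> p < size st.1 ->
    node r h (ins st p).1 (ins st p).2 /\
    exists2 c, local_rewrite st.1 (ins st p).1 p c
             & c + (ins st p).2 + 1 <= st.2 + 2 * h.
Proof.
have H (x : seq nat * nat * nat) : exists st' : seq nat * nat,
    node r h x.1.1 x.1.2 -> (size x.1.1).+1 < 2 * r ^ h -> x.2 < size x.1.1 ->
    node r h st'.1 st'.2 /\
    exists2 c, local_rewrite x.1.1 st'.1 x.2 c & c + st'.2 + 1 <= x.1.2 + 2 * h.
  (* Choice needs an answer everywhere; any state will do when the preconditions fail. *)
  have [[nd [sz px]]|no] := pselect (node r h x.1.1 x.1.2 /\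
     (size x.1.1).+1 < 2 * r ^ h /\ x.2 < size x.1.1).
    have [l' [f' [c [rw nd' cost]]]] := node_insert nd sz px.
    by exists (l', f') => _ _ _; split => //; exists c.
  by exists x.1 => nd sz px; case: no.
have [ins insP] := choice H.
by exists (fun st p => ins (st, p)) => st p; exact: (insP (st, p)).
Qed.

Lemma size_local_rewrite l l' p c :
  local_rewrite l l' p c -> size l' = (size l).+1.
Proof.
by case=> a [x [b [b' [e [-> -> sb _ _]]]]]; rewrite !size_cat /= !size_cat sb; lia.
Qed.

Lemma Rel_rcons A s y t : 0 < t <= size s -> Rel A (rcons s y) t = Rel A s t.
Proof.
case: t => // t /= ts; rewrite /Rel nth_rcons ts /=.
by rewrite -cats1 !takel_cat // ltnW.
Qed.

Lemma total_cost_rcons A s y :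
  total_cost A (rcons s y) = total_cost A s +
    size [seq z <- rcons s y | (z == y) || (A (rcons s y) z != A s z)].
Proof.
rewrite /total_cost size_rcons big_nat_recr //=; congr (_ + _).
  by apply: eq_big_nat => t /andP[t0 ts]; rewrite Rel_rcons // t0.
rewrite /Rel [_.+1.-1]/= nth_rcons ltnn eqxx -(size_rcons s y) take_size.
have -> : take (size s) (rcons s y) = s by rewrite -cats1 take_size_cat.
by [].
Qed.

(* The tree starts as a full node whose [r ^ k] entries play the role of dummy
   keys below all integers; hence all nodes satisfy the lower bound on their
   size from the start, and every new key has a predecessor. *)
Lemma online_labeling_upper_bound m k n r :
  n < r ^ k -> base r ^ k <= m ->
  exists2 A : algorithm, valid_algorithm n m A &
    forall s, uniq s -> size s <= n ->
      total_cost A s + size s <= 2 * k * size s.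
Proof.
move=> nr Bm; have [ins insP] := insertion_strategy r k.
have nd0 : node r k (full_node r k) 0.
  have [r0|] := posnP r; last exact: node_full_node.
  by subst r; case: k nr Bm insP => // k; rewrite exp0n.
move: (r ^ k) nr (size_full_node r k) insP => N nN sz0 insP.
have N0 : 0 < N by exact: leq_ltn_trans nN.
(* The fold runs over the reversed keys and records those already seen, whose ranks fix the
   position: the predecessor of [y] has index [N + rank - 1], and is the last dummy if [y] is
   smallest. *)
pose st := foldr (fun y (q : seq int * (seq nat * nat)) =>
   (y :: q.1, ins q.2 (N + rank (rev q.1) y).-1)) ([::], (full_node r k, 0)).
have st1 s : (st s).1 = s by elim: s => //= y s ->.
pose state s := (st (rev s)).2.
have stS s y : state (rcons s y) = ins (state s) (N + rank s y).-1.
  by rewrite /state rev_rcons /= st1 revK.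
(* Since [n < N], the root stays below [2 * N] entries and never splits. *)
have stepP s y : size s < n -> node r k (state s).1 (state s).2 ->
    size (state s).1 = N + size s ->
    node r k (state (rcons s y)).1 (state (rcons s y)).2 /\
    exists2 c, local_rewrite (state s).1 (state (rcons s y)).1 (N + rank s y).-1 c
             & c + (state (rcons s y)).2 + 1 <= (state s).2 + 2 * k.
  move=> sn nd sz; have rs : rank s y <= size s by exact: count_size.
  by rewrite stS; apply: insP => //; lia.
have stP s : size s <= n ->
    node r k (state s).1 (state s).2 /\ size (state s).1 = N + size s.
  elim/last_ind: s => [_|s y IH]; first by rewrite /state /= sz0 addn0.
  rewrite size_rcons => sn; have [nd sz] := IH (ltnW sn).
  have [nd' [c rw _]] := stepP s y sn nd sz.
  by split => //; rewrite (size_local_rewrite rw) sz addnS.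
pose A : algorithm := fun s y => nth 0 (state s).1 (N + rank s y).
exists A => [s us sn|].
  have [nd sz] := stP s sn; have [sl /allP gl] := node_sorted nd.
  have hom := sorted_ltn_nth ltn_trans 0 sl.
  have ix y : y \in s -> N + rank s y < size (state s).1.
    by move=> ys; rewrite sz ltn_add2l rank_size.
  split=> [y ys|x y xs ys xy]; last first.
    by apply: hom; rewrite ?inE ?ix // ltn_add2l rank_mono.
  apply/andP; split; last first.
    by apply: leq_trans Bm; apply/ltnW/gl/mem_nth/ix.
  (* Cells of the tree count from 0, but index 0 belongs to a dummy, so keys get cells from 1 on. *)
  apply: (@leq_ltn_trans (nth 0 (state s).1 0)) => //.
  by apply: hom; rewrite ?inE ?ix // ?addn_gt0 ?N0 // sz addn_gt0 N0.
(* The potential joins the invariant; the summand [size s] collects the 1 saved at each step,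
   turning [2 * k] into [2 * k - 1]. *)
suff H s : uniq s -> size s <= n ->
    total_cost A s + size s + (state s).2 <= 2 * k * size s.
  by move=> s us sn; apply: leq_trans (H s us sn); exact: leq_addr.
elim/last_ind: s => [_ _|s y IH us].
  by rewrite /total_cost big_geq // muln0.
rewrite size_rcons => sn.
have us' : uniq s by move: us; rewrite rcons_uniq => /andP[].
have {}IH := IH us' (ltnW sn).
have [nd sz] := stP s (ltnW sn).
have [_ [c rw cost]] := stepP s y sn nd sz.
have pE : (N + rank s y).-1.+1 = N + rank s y by rewrite prednK // addn_gt0 N0.
have total_le u : u <= c -> total_cost A s + u + (size s).+1 +
    (state (rcons s y)).2 <= 2 * k + 2 * k * size s.
  move: (total_cost A s) (size s) (state s).2 (state (rcons s y)).2 IH cost.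
  by clear; lia.
rewrite total_cost_rcons mulnS; apply: total_le.
exact: (relocated_le rw us pE).
Qed.

(** * Choice of the branching parameter *)

Lemma branching_exists m k n l :
  2 ^ l <= m -> 16 <= l -> 16 * k ^ 2 <= l -> n ^ 3 < l.+1 ^ k ->
  exists2 r, n < r ^ k & base r ^ k <= m.
Proof.
move=> lm l16 kl nl.
have [s /andP[s1 s2]] : exists s, s ^ 2 <= l < s.+1 ^ 2.
  elim: l {lm l16 kl nl} => [|l [s /andP[s1 s2]]]; first by exists 0.
  have [ls|ls] := ltnP l.+1 (s.+1 ^ 2); first by exists s; rewrite ls andbT; lia.
  by exists s.+1; rewrite ls /=; nia.
have s4 : 4 <= s by nia.
have ks : 4 * k <= s by nia.
exists s.
  (* From [s >= 4] follows [l + 1 <= (s + 1) ^ 2 <= s ^ 3]. *)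
  have : n ^ 3 < (s ^ k) ^ 3.
    rewrite -expnM mulnC expnM; apply: leq_trans nl _.
    have [->|k0] := posnP k; first by rewrite !expn0.
    by rewrite leq_exp2r //; nia.
  by rewrite ltn_exp2r.
have sB : base s <= 2 ^ (2 * s).
  by rewrite mul2n -addnn expnD leq_mul2r ltnW ?orbT // ltn_expl.
apply: leq_trans lm; apply: (@leq_trans ((2 ^ (2 * s)) ^ k)).
  by have [->|k0] := posnP k; rewrite ?expn0 // leq_exp2r.
by rewrite -expnM leq_exp2l //; nia.
Qed.

Local Open Scope ring_scope.

(** * From real logarithms to integers *)

Lemma log2_natX (R : realType) (l : nat) : log2 ((2 ^ l)%:R : R) = l%:R.
Proof.
have l20 : ln 2 != 0 :> R by rewrite gt_eqF // ln_gt0 // ltr1n.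
by rewrite /log2 natrX lnXn ?ltr0n // -[ln 2 *+ l]mulr_natl mulfK.
Qed.

Lemma ler_log2 (R : realType) (x y : R) : 0 < x -> x <= y -> log2 x <= log2 y.
Proof.
move=> x0 xy; rewrite /log2 ler_pM2r ?invr_gt0 ?ln_gt0 ?ltr1n //.
by rewrite ler_ln ?posrE // (lt_le_trans x0).
Qed.

Lemma ltr_log2 (R : realType) (x y : R) : 0 < x -> x < y -> log2 x < log2 y.
Proof.
move=> x0 xy; rewrite /log2 ltr_pM2r ?invr_gt0 ?ln_gt0 ?ltr1n //.
by rewrite ltr_ln ?posrE // (lt_trans x0).
Qed.

Lemma leq_trunc_log2 (e m : nat) : (2 ^ e < m)%N -> (e <= trunc_log 2 m)%N.
Proof. by move/ltnW; apply: trunc_log_max. Qed.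

(** As [L >= 16], [log2 L >= 4] turns the square root bound into [16 * k ^ 2 <= L]; cubing clears
    the exponent [k / 3]. Then [L < l + 1] passes to integers. *)
Lemma log2_bounds (R : realType) (m k n : nat) :
  (16 <= trunc_log 2 m)%N -> (1 <= k)%N ->
  k%:R <= 1 / 2 * Num.sqrt (log2 (m%:R : R) / log2 (log2 (m%:R : R))) ->
  n%:R <= log2 (m%:R : R) `^ (k%:R / 3) ->
  let l := trunc_log 2 m in
  [/\ (2 ^ l <= m)%N, (16 * k ^ 2 <= l)%N & (n ^ 3 < l.+1 ^ k)%N].
Proof.
move=> l16 hk hkm hnm l.
have m0 : (0 < m)%N by case: (m) l16.
have lm : (2 ^ l <= m)%N by exact: trunc_logP.
set L : R := log2 m%:R in hkm hnm.
have Ll : L < l.+1%:R.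
  by rewrite -log2_natX; apply: ltr_log2; rewrite ?ltr0n // ltr_nat trunc_log_ltn.
have lL : l%:R <= L.
  by rewrite -log2_natX; apply: ler_log2; rewrite ?ltr0n ?expn_gt0 // ler_nat.
have L16 : 16 <= L by apply: le_trans lL; rewrite ler_nat.
have LL4 : 4 <= log2 L.
  rewrite -[4](log2_natX R 4); apply: ler_log2; first by rewrite ltr0n.
  by apply: le_trans L16; rewrite ler_nat.
have kL : 16 * k%:R ^+ 2 <= L.
  have k0 : 0 <= k%:R :> R by rewrite ler0n.
  have q0 : 0 <= L / log2 L by apply: divr_ge0; lra.
  have : k%:R ^+ 2 <= (1 / 2 * Num.sqrt (L / log2 L)) ^+ 2.
    by rewrite ler_sqr ?nnegrE //; apply: mulr_ge0 => //; lra.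
  rewrite exprMn sqr_sqrtr //.
  have : L / log2 L <= L / 4.
    by apply: ler_wpM2l; [lra | rewrite lef_pV2 ?posrE; lra].
  lra.
split => //.
  have : (16 * k ^ 2 < l.+1)%N.
    by rewrite -(ltr_nat R) natrM natrX; apply: le_lt_trans Ll.
  by [].
rewrite -(ltr_nat R) !natrX; apply: (@le_lt_trans _ _ (L ^+ k)).
  have -> : L ^+ k = (L `^ (k%:R / 3)) ^+ 3.
    rewrite -[RHS]powR_mulrn ?powR_ge0 // -powRrM -mulrA mulVf ?pnatr_eq0 // mulr1.
    by rewrite powR_mulrn //; lra.
  by apply: lerXn2r; rewrite ?nnegrE ?ler0n ?powR_ge0.
by rewrite ltrXn2r -?lt0n ?ltW //; lra.
Qed.

(** * The value of the game *)

Lemma play_uniq_size n A B t :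
  valid_adversary n B -> (t <= n)%N ->
  uniq (unzip1 (play A B t)) /\ size (play A B t) = t.
Proof.
move=> vB; elim: t => //= t IH tn; have [u sz] := IH (ltnW tn).
rewrite /unzip1 map_rcons rcons_uniq size_rcons sz; split => //.
by rewrite u andbT; apply: vB; rewrite ?sz.
Qed.

(** Whatever a valid adversary does, the play is a sequence of [n] distinct keys, so adaptivity
    gains nothing over the worst fixed sequence. *)
Lemma chi_le (R : realType) (n m c : nat) (A : algorithm) :
  valid_algorithm n m A ->
  (forall s, uniq s -> size s = n -> (total_cost A s <= c)%N) ->
  (chi R n m <= c%:R%:E)%E.
Proof.
move=> vA hA; apply: (@le_trans _ _ (worst_case_cost R n A)).
  by apply: ereal_inf_lbound; exists A.
apply: ge_ereal_sup => _ [B vB <-]; rewrite lee_fin ler_nat.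
have [u sz] := play_uniq_size A vB (leqnn n).
by apply: hA; rewrite // size_map.
Qed.

Theorem theorem14 (R : realType) (m k n : nat)
  (hm : (2 ^ 16 < m)%N)
  (hk : (1 <= k)%N)
  (hkm : k%:R <= 1 / 2 * Num.sqrt (log2 (m%:R : R) / log2 (log2 (m%:R : R))))
  (hn : (1 <= n)%N)
  (hnm : n%:R <= log2 (m%:R : R) `^ (k%:R / 3)) :
  (chi R n m <= ((2 * k%:R - 1) * n%:R)%:E)%E /\
  exists A : algorithm, valid_algorithm n m A /\
    forall s : seq int, uniq s -> size s = n ->
      (total_cost A s)%:R / n%:R <= 2 * k%:R - 1 :> R.
Proof.
have l16 := leq_trunc_log2 hm; clear hm.
have [lm kl nl] := log2_bounds l16 hk hkm hnm.
have [r nr Bm] := branching_exists lm l16 kl nl.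
have [A vA costA] := online_labeling_upper_bound nr Bm.
have cost s : uniq s -> size s = n -> (total_cost A s <= (2 * k - 1) * n)%N.
  move=> us sn; have := costA s us; rewrite sn leqnn => /(_ isT).
  by rewrite mulnBl mul1n leq_subRL 1?addnC // leq_pmull // muln_gt0.
have cE : ((2 * k - 1) * n)%:R = (2 * k%:R - 1) * n%:R :> R.
  by rewrite natrM natrB ?muln_gt0 // natrM.
split; first by rewrite -cE; exact: chi_le vA cost.
exists A; split => // s us sn.
by rewrite ler_pdivrMr ?ltr0n // -cE ler_nat; exact: cost.
Qed.
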